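(* Let $K$ be a field of prime characteristic $p>0$, let $L=K(\theta)\simeq K[x]/(f(x))$ be a simple finite field extension of $K$, where $f(x)=f^{sep}(x^{p^n})=\sum_{i=0}^s\lambda_i x^{ip^n}\in K[x]$ (with $\lambda_i\in K$, $\lambda_s=1$) is the monic irreducible minimal polynomial of $\theta$ over $K$, written in its separable presentation, and let $N/K$ be a purely inseparable field extension (not necessarily finite). Then: 1. The polynomial $f_N=\sum_{i=0}^s\lambda_i^{1/p^{m_{f,N}}}x^{ip^{n-m_{f,N}}}$ is monic irreducible in $N[x]$ and monic irreducible in $M_{f,N}[x]$, where $M_{f,N}=K\big(\lambda_0^{1/p^{m_{f,N}}},\ldots,\lambda_{s-1}^{1/p^{m_{f,N}}}\big)$; moreover $f=f_N^{\,p^{m_{f,N}}}$ and $\deg(f_N)=sp^{n-m_{f,N}}$. 2. $N(\theta)\simeq N[x]/(f_N)$ and $[N(\theta):N]=\deg(f_N)=sp^{n-m_{f,N}}$.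
   Context: Fix an algebraic closure $\overline{K}$ of $K$ containing all fields considered (in particular $L$ and $N$). For $\lambda\in\overline{K}$ and $k\ge 0$, $\lambda^{1/p^k}$ denotes the unique $p^k$-th root of $\lambda$ in $\overline{K}$. Separable presentation: every non-scalar $f\in K[x]$ considered is written uniquely as $f(x)=f^{sep}(x^{p^n})$ with $f^{sep}\in K[x]$ a separable polynomial and $n\ge 0$; $n$ is the inseparability degree of $f$. Here $f^{sep}(x)=\sum_{i=0}^s\lambda_i x^i$. For a purely inseparable extension $N/K$, $m_{f,N}:=\max\{m'\in\{0,1,\ldots,n\}\mid \lambda_i^{1/p^{m'}}\in N\text{ for all } i=0,\ldots,s-1\}$. *)

(* Defs.v *)
From HB Require Import structures.
From mathcomp Require Import all_boot all_order all_algebra all_field.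
From mathcomp Require Import boolp classical_sets.

Set Implicit Arguments.
Unset Strict Implicit.
Unset Printing Implicit Defensive.

Import GRing.Theory.
Local Open Scope classical_set_scope.
Local Open Scope ring_scope.

(* A subfield of F is a predicate N : divringClosed F, which may have infinite
   degree over whatever base; [subf N] is the same subfield viewed as a
   fieldType, with inclusion [val : subf N -> F]. *)
Section SubfieldType.
Variables (F : fieldType) (N : divringClosed F).

Record subf := Subf { subf_val : F; _ : subf_val \in N }.

HB.instance Definition _ := [isSub for subf_val].
HB.instance Definition _ := [Choice of subf by <:].
HB.instance Definition _ := [SubChoice_isSubComUnitRing of subf by <:].
HB.instance Definition _ := [SubComUnitRing_isSubIntegralDomain of subf by <:].
HB.instance Definition _ := [SubIntegralDomain_isSubField of subf by <:].

End SubfieldType.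

Section Generated.
Variables (F : fieldType) (A : set F).

Definition gen_subfield : {pred F} :=
  fun x => `[< forall S : divringClosed F, A `<=` [set` S] -> x \in S >].

Fact gen_subfield_divring : divring_closed gen_subfield.
Proof.
split=> [|x y /asboolP hx /asboolP hy|x y /asboolP hx /asboolP hy];
  apply/asboolP=> S AS.
- exact: rpred1.
- by rewrite rpredB ?hx ?hy.
- by rewrite rpred_div ?hx ?hy.
Qed.

HB.instance Definition _ :=
  GRing.isDivringClosed.Build F gen_subfield gen_subfield_divring.

End Generated.

Definition purely_inseparable_ext (p : nat) (K F : fieldType)
    (iota : K -> F) (N : divringClosed F) : Prop :=
  (forall a, iota a \in N) /\
  (forall x, x \in N -> exists k a, x ^+ (p ^ k) = iota a).

(* [E : N] = d, for N contained in E: E has an N-basis with d elements. *)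
Definition ext_degree (F : fieldType) (N E : divringClosed F) (d : nat) : Prop :=
  {subset N <= E} /\
  exists b : 'I_d -> F, (forall i, b i \in E) /\
    forall x, x \in E ->
      exists! c : {ffun 'I_d -> subf N}, x = \sum_(i < d) val (c i) * b i.

(* g, whose coefficients are in F, has its coefficients in N, and is monic and
   irreducible in N[x]. *)
Definition monic_irreducible_in (F : fieldType) (N : divringClosed F)
    (g : {poly F}) : Prop :=
  exists h : {poly subf N},
    [/\ map_poly val h = g, h \is monic & irreducible_poly h].

(* N(theta) ~ N[x]/(g) as N-algebras, the class of x going to theta. The library
   quotient {poly %/ h} is the genuine N[x]/(h) only for h monic and
   nonconstant, hence the two side conditions. *)
Definition simple_ext_quotient (F : fieldType) (N : divringClosed F)
    (theta : F) (g : {poly F}) : Prop :=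
  exists h : {poly subf N},
    [/\ map_poly val h = g, h \is monic, (1 < size h)%N &
     exists phi : {rmorphism {poly %/ h} ->
                     subf (gen_subfield ([set` N] `|` [set theta]))},
       bijective phi /\
       forall q : {poly subf N},
         val (phi (in_qpoly h q)) = (map_poly val q).[theta]].

(* The p^k-th root of x; see proot_spec and proot_unique. *)
Definition proot (p : nat) (F : closedFieldType) (k : nat) (x : F) : F :=
  xget 0 [set y | y ^+ (p ^ k) = x].

Section RootSpec.
Variables (p : nat) (F : closedFieldType) (pcharFp : p \in [pchar F]).

Lemma proot_spec k x : proot p k x ^+ (p ^ k) = x :> F.
Proof.
rewrite /proot; case: xgetP => [y _ -> //|noroot].
have pk0 : (0 < p ^ k)%N by rewrite expn_gt0 prime_gt0 ?(pcharf_prime pcharFp).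
have /closed_rootP[y] : size ('X^(p ^ k) - x%:P) != 1.
  by rewrite size_XnsubC // eqSS -lt0n.
by rewrite rootE !hornerE subr_eq0 => /eqP/noroot.
Qed.

Lemma proot_unique k (x y : F) : y ^+ (p ^ k) = x -> y = proot p k x.
Proof.
elim: k y {1 2}(proot p k x) (proot_spec k x) => [|k IH] y z.
  by rewrite !expn0 !expr1 => -> ->.
rewrite expnS !exprM => zx yx.
suff: y ^+ p = z ^+ p by rewrite -!(pFrobenius_autE pcharFp) => /fmorph_inj.
exact: IH zx yx.
Qed.

End RootSpec.

(* m_{f,N}, where lam i (i < s) are the images in F of the coefficients of
   f^sep other than the leading one. *)
Definition m_exponent (p : nat) (F : closedFieldType) (N : divringClosed F)
    (n s : nat) (lam : nat -> F) : nat :=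
  \max_(k < n.+1 | [forall i : 'I_s, proot p k (lam i) \in N]) k.

(* Main.v *)
(* Let h be the minimal polynomial of theta over N. Some power h^(p^k) has
   coefficients in K, hence f divides h^(p^k); as h is irreducible over N, f is
   a power h^e. The roots of f have multiplicity p^n because f^sep is separable,
   so e divides p^n, say e = p^j. Uniqueness of p-th roots then forces
   h = \sum_i lambda_i^(1/p^j) x^(i p^(n-j)), whence j <= m. Conversely h
   divides f_N, and comparing degrees gives m <= j. So f_N = h, and everything
   else is the theory of the simple extension N(theta). Irreducibility over
   M_{f,N} follows from M_{f,N} being contained in N. *)
From HB Require Import structures.
Require Import Defs.
From mathcomp Require Import all_boot all_order all_algebra all_field.
From mathcomp Require Import boolp classical_sets.

Set Implicit Arguments.
Unset Strict Implicit.
Unset Printing Implicit Defensive.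

Import GRing.Theory.
Local Open Scope classical_set_scope.
Local Open Scope ring_scope.

(** * Polynomials with coefficients in a subfield *)

Lemma polyOver_subfP (F : fieldType) (N : divringClosed F) (g : {poly F}) :
  reflect (exists h : {poly subf N}, g = map_poly val h) (g \is a polyOver N).
Proof.
apply: (iffP polyOverP) => [gN|[h ->] i]; last by rewrite coef_map; apply: valP.
exists (\poly_(i < size g) Subf (gN i)); apply/polyP => i.
rewrite coef_map coef_poly; case: ltnP => // /(nth_default 0) ->.
by rewrite raddf0.
Qed.

(** Moves irreducibility over [N] into [F[x]], where different subfields can be compared. *)
Lemma monic_irreducible_inP (F : fieldType) (N : divringClosed F) (g : {poly F}) :
  monic_irreducible_in N g <->
  [/\ g \is a polyOver N, g \is monic, (1 < size g)%N &
   forall q, q \is a polyOver N -> size q != 1%N -> q %| g -> q %= g].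
Proof.
split=> [[h [<- h_monic [h_size h_irr]]]|].
  split; rewrite ?map_monic ?size_map_poly //; first by apply/polyOver_subfP; exists h.
  move=> _ /polyOver_subfP[q ->].
  by rewrite size_map_poly dvdp_map eqp_map; apply: h_irr.
case=> /polyOver_subfP[h ->]; rewrite map_monic size_map_poly => h_monic h_size h_irr.
exists h; split=> //; split=> // q q_size qh.
rewrite -(eqp_map (val : subf N -> F)) h_irr ?size_map_poly ?dvdp_map //.
by apply/polyOver_subfP; exists q.
Qed.

(** A factor over [M] is also a factor over [N], divisibility being tested in [F[x]] for both. *)
Lemma monic_irreducible_in_sub (F : fieldType) (M N : divringClosed F) (g : {poly F}) :
  {subset M <= N} -> g \is a polyOver M ->
  monic_irreducible_in N g -> monic_irreducible_in M g.
Proof.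
move=> MN gM /monic_irreducible_inP[_ g_monic g_size g_irr].
apply/monic_irreducible_inP; split=> // q qM; apply: g_irr.
exact: polyOverS qM.
Qed.

(** * Powers of Frobenius *)

Section Frobenius.
Variables (p : nat) (R : comNzRingType) (pcharRp : p \in [pchar R]).

Lemma exprD_pexp k (x y : R) : (x + y) ^+ (p ^ k) = x ^+ (p ^ k) + y ^+ (p ^ k).
Proof.
apply: exprDn_pchar; rewrite pnatX; apply/orP; left.
by rewrite pnatE ?(pcharf_prime pcharRp).
Qed.

Lemma expr_pexp_sum k (I : Type) (r : seq I) (P : pred I) (G : I -> R) :
  (\sum_(i <- r | P i) G i) ^+ (p ^ k) = \sum_(i <- r | P i) G i ^+ (p ^ k).
Proof.
apply: (big_morph (fun x => x ^+ (p ^ k)) (@exprD_pexp k)).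
by rewrite expr0n eqn0Ngt expn_gt0 prime_gt0 ?(pcharf_prime pcharRp).
Qed.

End Frobenius.

Lemma expr_pexp_inj (p k : nat) (R : idomainType) : p \in [pchar R] ->
  injective (fun x : R => x ^+ (p ^ k)).
Proof.
move=> pcharRp x y /= xy; apply/eqP; rewrite -subr_eq0.
(* Additivity of the power map is applied to [(x - y) + y]. *)
have : (x - y) ^+ (p ^ k) == 0.
  have := exprD_pexp pcharRp k (x - y) y; rewrite subrK xy => /esym/eqP.
  by rewrite -subr_eq0 addrK.
by rewrite expf_eq0 => /andP[].
Qed.

Lemma mupX (F : fieldType) (x : F) (q : {poly F}) e : q != 0 ->
  mup x (q ^+ e) = (e * mup x q)%N.
Proof.
move=> q0; elim: e => [|e IH]; first by rewrite mupNroot // root1.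
by rewrite exprS mupM ?expf_neq0 // IH mulSn.
Qed.

(** * Values at a root of an irreducible polynomial *)

Section Evaluation.
Variables (K F : fieldType) (iota : {rmorphism K -> F}) (theta : F) (h : {poly K}).
Hypotheses (h_irr : irreducible_poly h) (h_theta : root (map_poly iota h) theta).

Local Notation ev q := (map_poly iota q).[theta].

(** If [h] does not divide [q], the two are coprime, also after [iota], and share no root. *)
Lemma root_irreducible_dvdp q : root (map_poly iota q) theta = (h %| q).
Proof.
apply/idP/idP => [|hq]; last first.
  by move: h_theta; rewrite -!dvdp_XsubCl => /dvdp_trans; apply; rewrite dvdp_map.
apply: contraTT; rewrite -irreducible_poly_coprime // => hq.
by rewrite rootE (coprimep_root _ h_theta) // coprimep_map.
Qed.

Lemma ev_modp q : ev (q %% h) = ev q.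
Proof.
rewrite [in RHS](divp_eq q h) rmorphD rmorphM !hornerE.
by rewrite (rootP h_theta) mulr0 add0r.
Qed.

(** The difference is a multiple of [h] smaller than [h], hence zero. This yields both injectivity
    on the quotient and independence of the powers of [theta]. *)
Lemma ev_inj_small (q r : {poly K}) :
  (size q < size h)%N -> (size r < size h)%N -> ev q = ev r -> q = r.
Proof.
move=> qh rh qr; apply/eqP; rewrite -subr_eq0.
have: h %| q - r.
  by rewrite -root_irreducible_dvdp rmorphB; apply/rootP; rewrite !hornerE qr subrr.
apply: contraTT => qr0; rewrite gtNdvdp // (leq_ltn_trans (size_polyD _ _)) //.
by rewrite size_polyN gtn_max qh.
Qed.

Fact evals_divring : divring_closed (fun x => `[< exists q, x = ev q >]).
Proof.
split=> [|x y /asboolP[q ->] /asboolP[r ->]|x y /asboolP[q ->] /asboolP[r ->]].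
- by apply/asboolP; exists 1; rewrite rmorph1 hornerC.
- by apply/asboolP; exists (q - r); rewrite rmorphB !hornerE.
have [->|r0] := eqVneq (ev r) 0.
  by apply/asboolP; exists 0; rewrite rmorph0 invr0 mulr0 horner0.
have : coprimep h r by rewrite irreducible_poly_coprime // -root_irreducible_dvdp.
(* Evaluating [u * h + v * r = 1] at [theta] shows that the value of [v] inverts that of [r]. *)
case/Bezout_eq1_coprimepP => -[u v] /= uv.
apply/asboolP; exists (q * v); rewrite rmorphM hornerM; congr (_ * _).
apply: (mulIf r0); rewrite mulVf // -hornerM -rmorphM.
move/(congr1 (fun q : {poly K} => ev q)): uv.
by rewrite rmorphD rmorphM rmorph1 hornerD hornerM hornerC (rootP h_theta) mulr0 add0r => ->.
Qed.

End Evaluation.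

(* Naming the morphism keeps rmorph rewriting from normalizing it to the
   canonical instances behind [val]. *)
Definition incl (F : fieldType) (N : divringClosed F) :
  {rmorphism subf N -> F} := val.
Arguments incl : simpl never.

(** * The simple extension N(theta) *)

Section SimpleExtension.
Variables (F : fieldType) (N : divringClosed F) (theta : F) (h : {poly subf N}).

Local Notation incl := (incl N).
Hypotheses (h_monic : h \is monic) (h_irr : irreducible_poly h).
Hypothesis h_theta : root (map_poly incl h) theta.

Local Notation ev q := (map_poly incl q).[theta].
Local Notation Ntheta := (gen_subfield ([set` N] `|` [set theta])).

(** The values form a subfield containing [N] and [theta], and every such subfield contains them. *)
Lemma gen_subfield_evalP x : reflect (exists q, x = ev q) (x \in Ntheta).
Proof.
pose E : {pred F} := fun x => `[< exists q, x = ev q >].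
pose S : divringClosed F :=
  HB.pack E (GRing.isDivringClosed.Build F E (evals_divring h_irr h_theta)).
apply: (iffP (asboolP _)) => [/(_ S) xS|[q ->] T NT].
  apply/asboolP/xS => y [yN|->]; apply/asboolP.
    by exists (Subf yN)%:P; rewrite map_polyC hornerC.
  by exists 'X; rewrite map_polyX hornerX.
rewrite rpred_horner //; last by apply: NT; right.
apply/polyOverP => i; rewrite coef_map; apply: NT; left; exact: valP.
Qed.

Lemma ev_in q : ev q \in Ntheta.
Proof. by apply/gen_subfield_evalP; exists q. Qed.

Lemma mk_monic_irreducible : mk_monic h = h.
Proof. by rewrite /mk_monic h_monic h_irr.1. Qed.

Definition qpoly_eval (x : {poly %/ h}) : subf Ntheta := Subf (ev_in (x : {poly _})).

Lemma qpoly_eval_in q : val (qpoly_eval (in_qpoly h q)) = ev q.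
Proof.
rewrite /= mk_monic_irreducible -Pdiv.IdomainMonic.modpE //.
exact: (ev_modp h_theta).
Qed.

Fact qpoly_eval_additive : zmod_morphism qpoly_eval.
Proof.
move=> x y; apply: val_inj; change (ev ((x : {poly _}) - y) = ev x - ev y).
by rewrite rmorphB !hornerE.
Qed.

Fact qpoly_eval_multiplicative : monoid_morphism qpoly_eval.
Proof.
split=> [|x y]; apply: val_inj.
  by change (ev 1 = 1); rewrite rmorph1 hornerC.
(* The product in the quotient is by definition the class of the product of representatives. *)
by rewrite [LHS]qpoly_eval_in rmorphM hornerM.
Qed.

HB.instance Definition _ := GRing.isZmodMorphism.Build _ _ qpoly_eval qpoly_eval_additive.
HB.instance Definition _ :=
  GRing.isMonoidMorphism.Build _ _ qpoly_eval qpoly_eval_multiplicative.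

Lemma simple_ext_quotient_irreducible :
  simple_ext_quotient N theta (map_poly val h).
Proof.
exists h; split=> //; first by case: h_irr.
exists qpoly_eval; split; last exact: qpoly_eval_in.
have size_h x : (size (x : {poly %/ h}) < size h)%N.
  by apply: leq_trans (size_mk_monic x) _; rewrite mk_monic_irreducible.
have evK (y : subf Ntheta) : exists x, qpoly_eval x = y.
  have /gen_subfield_evalP[q yq] := valP y.
  by exists (in_qpoly h q); apply: val_inj; rewrite qpoly_eval_in.
(* The inverse chooses a preimage; by [evK] the default [0] is never a fallback. *)
exists (fun y => xget 0 [set x | qpoly_eval x = y]) => [x|y]; last first.
  by case: xgetP => [//|no]; have [x /no] := evK y.
case: xgetP => [y _ /(congr1 val) xy|/(_ x)/(_ erefl) //].
apply: val_inj; apply: (ev_inj_small h_irr h_theta); first exact: size_h.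
  exact: size_h.
exact: xy.
Qed.

(** The basis consists of the powers of [theta] below the degree of [h]: division by [h] gives
    existence, [ev_inj_small] uniqueness. *)
Lemma ext_degree_irreducible : ext_degree N Ntheta (size h).-1.
Proof.
have h0 : (0 < size h)%N by apply: ltn_trans h_irr.1.
have sub_N : {subset N <= Ntheta}.
  move=> x xN; apply/gen_subfield_evalP; exists (Subf xN)%:P.
  by rewrite map_polyC hornerC.
have evE (c : nat -> subf N) d : ev (\poly_(i < d) c i) = \sum_(i < d) val (c i) * theta ^+ i.
  apply: etrans (horner_poly d (fun i => incl (c i)) theta).
  congr _.[_]; apply/polyP => i.
  by rewrite coef_map !coef_poly; case: ifP => // _; rewrite rmorph0.
split=> //; exists (fun i => theta ^+ i); split=> [i|x /gen_subfield_evalP[q ->]].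
  by apply/gen_subfield_evalP; exists 'X^i; rewrite map_polyXn hornerXn.
have size_q : (size (q %% h)%R <= (size h).-1)%N.
  by rewrite -ltnS prednK // ltn_modp -size_poly_gt0.
have qE : q %% h = \poly_(i < (size h).-1) (q %% h)`_i.
  apply/polyP=> i; rewrite coef_poly; case: ltnP => // le_i.
  by rewrite nth_default // (leq_trans size_q).
rewrite -(ev_modp h_theta).
exists [ffun i : 'I_(size h).-1 => (q %% h)`_i]; split=> [|c].
  by rewrite {1}qE evE; apply: eq_bigr => i _; rewrite ffunE.
(* Extension of [c] by zero to all naturals, as [\poly] requires. *)
pose c' i := if insub i is Some j then c j else 0.
have c'E (i : 'I_(size h).-1) : c' i = c i by rewrite /c' valK.
move=> evc; apply/ffunP => i; rewrite ffunE.
have -> : q %% h = \poly_(i < (size h).-1) c' i.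
  apply: (ev_inj_small h_irr h_theta).
  - by rewrite ltn_modp -size_poly_gt0.
  - by rewrite -[X in (_ < X)%N](prednK h0) ltnS size_poly.
  by rewrite evE evc; apply: eq_bigr => j _; rewrite c'E.
by rewrite coef_poly ltn_ord c'E.
Qed.

End SimpleExtension.

(** * Powers of irreducible polynomials and substitution of powers of x *)

Lemma monic_dvdp_irreducible_exp (K : fieldType) (h g : {poly K}) m :
  irreducible_poly h -> h \is monic -> g \is monic -> g %| h ^+ m ->
  exists e, g = h ^+ e.
Proof.
move=> h_irr h_monic; elim: m g => [|m IH] g g_monic.
  rewrite expr0 dvdp1 => g1; exists 0%N; apply/eqP.
  by rewrite expr0 -eqp_monic ?monic1 // -size_poly_eq1.
(* Either one factor [h] cancels on both sides, or [g] is coprime to [h] and Gauss's lemma lowers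
   the exponent. *)
have [/dvdpP[r gE]|hNg] := boolP (h %| g); last first.
  rewrite exprS Gauss_dvdpr; first exact: IH.
  by rewrite coprimep_sym irreducible_poly_coprime.
move: g_monic; rewrite gE exprSr dvdp_mul2r ?monic_neq0 // monicMr //.
by move=> r_monic /(IH r r_monic)[e ->]; exists e.+1; rewrite exprSr.
Qed.

Lemma sum_scale_polyXn (R : comNzRingType) (s d : nat) (c : nat -> R) :
  \sum_(i < s.+1) c i *: 'X^(i * d) = (\poly_(i < s.+1) c i) \Po 'X^d.
Proof.
rewrite poly_def raddf_sum; apply: eq_bigr => i _.
by rewrite /= linearZ /= comp_Xn_poly -exprM mulnC.
Qed.

Lemma size_comp_poly_Xn (R : idomainType) (q : {poly R}) (s d : nat) :
  (0 < d)%N -> size q = s.+1 -> size (q \Po 'X^d) = (s * d).+1.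
Proof.
move=> d0 q_size; have q0 : q \Po 'X^d != 0.
  by rewrite comp_poly_eq0 ?size_polyXn ?ltnS // -size_poly_eq0 q_size.
by rewrite -[LHS]prednK ?size_poly_gt0 // size_comp_poly q_size size_polyXn.
Qed.

(** * Descent to K along a purely inseparable extension *)

Section PurelyInseparable.
Variables (p : nat) (K F : fieldType) (iota : {rmorphism K -> F}).
Variable N : divringClosed F.
Hypotheses (pcharKp : p \in [pchar K]) (NK : purely_inseparable_ext p iota N).

Lemma purely_inseparable_poly_pexp (h : {poly subf N}) :
  exists k q, map_poly (incl N) h ^+ (p ^ k) = map_poly iota q.
Proof.
have pcharP : p \in [pchar {poly F}] by rewrite pchar_poly (rmorph_pchar iota).
elim/poly_ind: h => [|h c [k [q hq]]].
  by exists 0%N, 0; rewrite !rmorph0 expr1.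
have [l [a ca]] := NK.2 _ (valP c).
(* The exponents [k] for [h] and [l] for [c] are raised to the common value [k + l]. *)
exists (k + l)%N, (q ^+ (p ^ l) * 'X^(p ^ (k + l)) + (a ^+ (p ^ k))%:P).
have -> : map_poly (incl N) (h * 'X + c%:P) = map_poly (incl N) h * 'X + (incl N c)%:P.
  by rewrite rmorphD rmorphM /= (map_polyX (incl N)) (map_polyC (incl N)).
rewrite (exprD_pexp pcharP) exprMn.
rewrite rmorphD rmorphM /= map_polyXn map_polyC /= !rmorphXn /= -hq -ca.
by rewrite polyC_exp -!exprM -!expnD (addnC l).
Qed.

Variables (theta : F) (f : {poly K}) (h : {poly subf N}).
Hypotheses (f_monic : f \is monic) (f_irr : irreducible_poly f).
Hypothesis f_theta : root (map_poly iota f) theta.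
Hypotheses (h_monic : h \is monic) (h_irr : irreducible_poly h).
Hypothesis h_theta : root (map_poly (incl N) h) theta.

Lemma irreducible_eq_exp : exists e, map_poly iota f = map_poly (incl N) h ^+ e.
Proof.
have [k [q hq]] := purely_inseparable_poly_pexp h.
have pk0 : (0 < p ^ k)%N by rewrite expn_gt0 prime_gt0 ?(pcharf_prime pcharKp).
have fq : f %| q.
  rewrite -(root_irreducible_dvdp f_irr f_theta) -hq.
  by rewrite rootE horner_exp (rootP h_theta) expf_eq0 pk0 eqxx.
have [g fg] : exists g : {poly subf N}, map_poly iota f = map_poly (incl N) g.
  apply/polyOver_subfP/polyOverP => i; rewrite coef_map; exact: NK.1.
have /(monic_dvdp_irreducible_exp h_irr h_monic) : g %| h ^+ (p ^ k).
  by rewrite -(dvdp_map (incl N)) -fg rmorphXn /= hq dvdp_map.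
case=> [|e gE]; first by rewrite -(map_monic (incl N)) -fg map_monic.
by exists e; rewrite fg gE rmorphXn.
Qed.

End PurelyInseparable.

(** [x ^+ (p ^ n)] is a simple root of [g]; its linear factor becomes the [p ^ n]-th power of
    ['X - x%:P], and the cofactor does not vanish at [x]. *)
Lemma mup_separable_comp (p n : nat) (F : fieldType) (g : {poly F}) (x : F) :
  p \in [pchar F] -> separable_poly g -> root (g \Po 'X^(p ^ n)) x ->
  mup x (g \Po 'X^(p ^ n)) = (p ^ n)%N.
Proof.
move=> pcharFp g_sep; rewrite root_comp hornerXn => /factor_theorem[r gE].
move: g_sep; rewrite gE separable_root => /andP[_ rx].
rewrite comp_polyM.
have -> : ('X - (x ^+ (p ^ n))%:P) \Po 'X^(p ^ n) = ('X - x%:P) ^+ (p ^ n).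
  have pcharP : p \in [pchar {poly F}] by rewrite pchar_poly.
  rewrite comp_polyB comp_polyX comp_polyC; apply/eqP; rewrite subr_eq rmorphXn.
  by rewrite -(exprD_pexp pcharP) subrK.
by rewrite mupMr ?mup_XsubCX ?eqxx // root_comp hornerXn.
Qed.

(** * The exponent m_{f,N} *)

Lemma m_exponent_le (p : nat) (F : closedFieldType) (N : divringClosed F) n s lam :
  (m_exponent p N n s lam <= n)%N.
Proof. by apply/bigmax_leqP => k _; rewrite -ltnS. Qed.

Lemma m_exponent_mem (p : nat) (F : closedFieldType) (N : divringClosed F) n s (lam : nat -> F) :
  p \in [pchar F] -> (forall i : 'I_s, lam i \in N) ->
  forall i, (i < s)%N -> proot p (m_exponent p N n s lam) (lam i) \in N.
Proof.
move=> pcharFp lamN i i_s; rewrite /m_exponent.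
set P := fun k : 'I_n.+1 => [forall i : 'I_s, proot p k (lam i) \in N].
(* Exponent 0 is admissible, so the maximum is attained. *)
have P0 : P ord0.
  by apply/forallP => j; rewrite -(@proot_unique p _ pcharFp 0 _ (lam j)) ?lamN.
have [|k Pk ->] := @eq_bigmax_cond _ P (fun k => k : nat).
  by apply/card_gt0P; exists ord0.
exact: (forallP Pk (Ordinal i_s)).
Qed.

(** * The candidates for the minimal polynomial over N *)

Section RootPolynomial.
Variables (p : nat) (F : closedFieldType) (g : {poly F}) (n s : nat).
Hypotheses (pcharFp : p \in [pchar F]) (g_monic : g \is monic).
Hypothesis g_size : size g = s.+1.

(** [j] stays free: f_N is the case [j = m], but the minimal polynomial over [N] is first found for
    a [j] not yet known to be [m]. *)
Definition root_poly j : {poly F} :=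
  \sum_(i < s.+1) proot p j g`_i *: 'X^(i * p ^ (n - j)).

Let pexp_gt0 k : (0 < p ^ k)%N.
Proof. by rewrite expn_gt0 prime_gt0 ?(pcharf_prime pcharFp). Qed.

Let pcharP : p \in [pchar {poly F}].
Proof. by rewrite pchar_poly. Qed.

Lemma proot_lead j : proot p j g`_s = 1.
Proof.
apply/esym/(proot_unique pcharFp); rewrite expr1n.
by have /monicP := g_monic; rewrite /lead_coef g_size.
Qed.

Lemma root_poly_coef j i : (i <= s)%N ->
  (root_poly j)`_(i * p ^ (n - j)) = proot p j g`_i.
Proof.
move=> i_s; rewrite /root_poly (sum_scale_polyXn _ _ (fun i => proot p j g`_i)).
by rewrite coef_comp_poly_Xn // dvdn_mull // mulnK // coef_poly ltnS i_s.
Qed.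

Lemma size_root_poly j : size (root_poly j) = (s * p ^ (n - j)).+1.
Proof.
rewrite /root_poly (sum_scale_polyXn _ _ (fun i => proot p j g`_i)).
by rewrite (@size_comp_poly_Xn _ _ s) // size_poly_eq ?proot_lead ?oner_eq0.
Qed.

Lemma root_poly_monic j : root_poly j \is monic.
Proof.
by rewrite monicE /lead_coef size_root_poly root_poly_coef // proot_lead.
Qed.

Lemma root_poly_pexp j : (j <= n)%N -> root_poly j ^+ (p ^ j) = g \Po 'X^(p ^ n).
Proof.
move=> jn; rewrite (expr_pexp_sum pcharP) comp_polyE g_size; apply: eq_bigr => i _.
rewrite exprZn proot_spec // -!exprM -mulnA -expnD subnK //.
by rewrite mulnC.
Qed.

End RootPolynomial.

Theorem theorem3p5
  (p : nat) (K : fieldType) (pcharKp : p \in [pchar K])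
  (* Kbar, with iota, is an algebraic closure of K *)
  (Kbar : closedFieldType) (iota : {rmorphism K -> Kbar})
  (algKbar : forall x : Kbar, algebraicOver iota x)
  (* L = K(theta), with f the minimal polynomial of theta over K *)
  (theta : Kbar) (L : divringClosed Kbar)
  (L_def : L =i gen_subfield (range iota `|` [set theta]))
  (f : {poly K}) (f_monic : f \is monic) (f_irr : irreducible_poly f)
  (f_theta : root (map_poly iota f) theta)
  (* separable presentation of f *)
  (fsep : {poly K}) (n s : nat)
  (fsep_separable : separable_poly fsep)
  (f_def : f = fsep \Po 'X^(p ^ n)) (fsep_size : size fsep = s.+1)
  (N : divringClosed Kbar) (NK : purely_inseparable_ext p iota N) :
  let lam (i : nat) : Kbar := iota fsep`_i in
  let m := m_exponent p N n s lam in
  let fN : {poly Kbar} :=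
    \sum_(i < s.+1) proot p m (lam i) *: 'X^(i * p ^ (n - m)) in
  let M := gen_subfield (range iota `|` [set proot p m (lam i) | i in `I_s]) in
  let Ntheta := gen_subfield ([set` N] `|` [set theta]) in
  [/\ monic_irreducible_in N fN, monic_irreducible_in M fN,
      map_poly iota f = fN ^+ (p ^ m) & size fN = (s * p ^ (n - m)).+1]
  /\ (simple_ext_quotient N theta fN /\
      ext_degree N Ntheta (s * p ^ (n - m))).

Proof.
move=> lam m fN M Ntheta.
have pcharF : p \in [pchar Kbar] by rewrite (rmorph_pchar iota).
have p_gt0 k : (0 < p ^ k)%N by rewrite expn_gt0 prime_gt0 ?(pcharf_prime pcharF).
have pcharP : p \in [pchar {poly Kbar}] by rewrite pchar_poly.
pose g := map_poly iota fsep.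
have g_size : size g = s.+1 by rewrite size_map_poly.
have fg : map_poly iota f = g \Po 'X^(p ^ n) by rewrite f_def map_comp_poly map_polyXn.
have fsep_monic : fsep \is monic.
  move: f_monic; rewrite !monicE f_def lead_coef_comp ?size_polyXn ?ltnS //.
  by rewrite lead_coefXn expr1n mulr1.
have g_monic : g \is monic by rewrite map_monic.
have fNE : fN = root_poly p g n s m.
  by apply: eq_bigr => i _; rewrite coef_map.
have m_n : (m <= n)%N by apply: m_exponent_le.
have lamN i : lam i \in N by apply: NK.1.
have fN_coefN i : (i <= s)%N -> proot p m (lam i) \in N.
  (* [m] only controls the indices below [s]; the leading coefficient is 1. *)
  rewrite leq_eqVlt => /predU1P[->|]; last exact: m_exponent_mem.
  by have := proot_lead pcharF g_monic g_size m; rewrite coef_map => ->; apply: rpred1.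
have fN_pexp : fN ^+ (p ^ m) = map_poly iota f by rewrite fNE root_poly_pexp.
have fN_monic : fN \is monic by rewrite fNE root_poly_monic.
have fN_size : size fN = (s * p ^ (n - m)).+1 by rewrite fNE size_root_poly.
have fN_theta : root fN theta.
  by move: f_theta; rewrite -fN_pexp !rootE horner_exp expf_eq0 => /andP[].
have [fN' fN'E] : exists h : {poly subf N}, fN = map_poly (incl N) h.
  apply/polyOver_subfP; apply: rpred_sum => i _.
  by rewrite polyOverZ ?rpredX ?polyOverX // fN_coefN // -ltnS.
have s_gt0 : (0 < s)%N.
  have := f_irr.1; rewrite -(size_map_poly iota) fg (size_comp_poly_Xn _ g_size) //.
  by rewrite ltnS muln_gt0 => /andP[].
have [h [h_monic h_theta h_irr]] : {h : {poly subf N} |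
    [/\ h \is monic, root (map_poly (incl N) h) theta & irreducible_poly h]}.
  (* [theta] is algebraic over [N], being a root of the monic [fN']. *)
  apply: minPoly_decidable_closure; first by move=> x; apply: pselect.
  by exists fN'; rewrite -?fN'E // -(map_monic (incl N)) -fN'E.
pose G := map_poly (incl N) h.
have G_neq0 : G != 0 by rewrite monic_neq0 // map_monic.
have [e fGe] := irreducible_eq_exp pcharKp NK f_monic f_irr f_theta h_monic h_irr h_theta.
have [j jn eE] : exists2 j, (j <= n)%N & e = (p ^ j)%N.
  apply/(dvdn_pfactor _ _ (pcharf_prime pcharF)).
  (* The multiplicity of [theta] is [p ^ n] in f and a multiple of [e] in [G ^+ e]. *)
  have := mup_separable_comp (n := n) (g := g) (x := theta) pcharF.
  rewrite separable_map -fg fGe mupX // => <- //; last by rewrite -fGe.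
  exact: dvdn_mulr.
have GE : G = root_poly p g n s j.
  (* Both sides have f as their [p ^ j]-th power. *)
  apply: (expr_pexp_inj (k := j) pcharP); rewrite /= root_poly_pexp // -fg fGe eE //.
have j_m : (j <= m)%N.
  (* The required roots are coefficients of [G], so they lie in [N]. *)
  rewrite /m /m_exponent; apply: (leq_bigmax_cond (Ordinal (jn : (j < n.+1)%N))).
  apply/forallP => i; rewrite /lam -coef_map -(@root_poly_coef _ _ g n s) //; last exact: ltnW.
  by rewrite -GE coef_map; apply: valP.
have G_fN : G %| fN by rewrite fN'E dvdp_map -(root_irreducible_dvdp h_irr h_theta) -fN'E.
have mj : m = j.
  apply/eqP; rewrite eqn_leq j_m andbT.
  have := dvdp_leq (monic_neq0 fN_monic) G_fN.
  (* Positivity of [s] lets it cancel from the degrees, leaving [n - j <= n - m]. *)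
  rewrite fN_size GE size_root_poly // ltnS leq_pmul2l //.
  rewrite leq_exp2l ?prime_gt1 ?(pcharf_prime pcharF) // => le_nm.
  by rewrite -(subKn m_n) -(subKn jn) leq_sub2l.
have fNh : fN = G by rewrite GE -mj -fNE.
have irrN : monic_irreducible_in N fN by exists h.
split; last first.
  split; first by rewrite fNh; apply: simple_ext_quotient_irreducible.
  have := ext_degree_irreducible h_irr h_theta.
  by rewrite -(size_map_poly (incl N)) -/G -fNh fN_size.
(* The generators of [M] lie in [N], and f_N has its coefficients in [M]. *)
split=> //; apply: monic_irreducible_in_sub irrN.
  move=> x /asboolP; apply=> y [[a _ <-]|[i /= i_s <-]]; first exact: NK.1.
  exact/fN_coefN/ltnW.
apply: rpred_sum => i _; rewrite polyOverZ ?rpredX ?polyOverX //.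
have := ltn_ord i; rewrite ltnS leq_eqVlt => /predU1P[->|i_s].
  by have := proot_lead pcharF g_monic g_size m; rewrite coef_map => ->; apply: rpred1.
by apply/asboolP => S; apply; right; exists i.
Qed.
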